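(* Let $S$ be a proper sampling on $[n]$ with weights $\theta_S^i=1/p_i$, where $p_i=\mathbb{P}[i\in S]$. Let each $f_i:\mathbb{R}^d\to\mathbb{R}$ be $L_i$-smooth and convex, and let $f=\frac1n\sum_{i=1}^nf_i$ be $L_f$-smooth and convex. Let $\mathcal{L}_2$ be the expected smoothness constant defined in the context. (i) If $S$ is the $\tau$-nice sampling (with $n\ge2$), then $$\mathcal{L}_2\le\frac{n-\tau}{\tau(n-1)}\max_{i\in[n]}L_i.$$ (ii) If $S$ is a group sampling with set of isolated indices $\mathcal{I}$, then $$\mathcal{L}_2\le\frac1n\max\left\{\max_{i\in\mathcal{I}}\left(\frac{1}{p_i}-1\right)L_i,\ \max_{i\notin\mathcal{I}}\frac{L_i}{p_i}\right\}.$$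
   Context: $[n]=\{1,\dots,n\}$; $e\in\mathbb{R}^n$ is the all-ones vector. A sampling is a random subset $S$ of $[n]$; it is proper if $p_i=\mathbb{P}[i\in S]>0$ for all $i$. $L$-smooth means differentiable with $L$-Lipschitz gradient. A maximum over an empty index set is omitted. $\tau$-nice sampling: $S$ is uniformly distributed over all subsets of $[n]$ of cardinality $\tau$ ($1\le\tau\le n$). Group sampling: numbers $p_i\in(0,1]$ are given; $[n]$ is partitioned into groups $C_1,\dots,C_t$ with $\sum_{i\in C_j}p_i\le1$ for every $j$; independently over groups, with probability $\sum_{i\in C_j}p_i$ exactly one index is chosen from $C_j$ (otherwise none), the chosen index being $i\in C_j$ with probability $p_i/\sum_{s\in C_j}p_s$. $S$ is the set of chosen indices, so $\mathbb{P}[i\in S]=p_i$. An index $i$ is isolated if $\{i\}$ is itself one of the groups. $\theta_S$ is the diagonal matrix with entries $\theta_S^i$, $\mathbf{I}_S$ is the diagonal $0/1$ indicator matrix of $S$, and $\mathbf{G}(x)=[\nabla f_1(x),\dots,\nabla f_n(x)]$, so $\frac1n\mathbf{G}(x)\theta_S\mathbf{I}_Se=\frac1n\sum_{i\in S}\theta_S^i\nabla f_i(x)$. $\mathcal{L}_2$ is the smallest constant $\ge0$ such that for all $x,y\in\mathbb{R}^d$: $\mathbb{E}\left[\|\frac1n(\mathbf{G}(x)-\mathbf{G}(y))\theta_S\mathbf{I}_Se-\frac1n(\mathbf{G}(x)-\mathbf{G}(y))e\|^2\right]\le2\mathcal{L}_2(f(x)-f(y)-\langle\nabla f(y),x-y\rangle)$.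 *)

(* Defs.v *)
From mathcomp Require Import all_boot all_order all_algebra.
From mathcomp Require Import all_classical all_reals all_analysis.

Set Implicit Arguments.
Unset Strict Implicit.
Unset Printing Implicit Defensive.

Import Order.TTheory GRing.Theory Num.Theory.
Import numFieldNormedType.Exports.

Local Open Scope classical_set_scope.
Local Open Scope ring_scope.

Section Euclidean.
Context {R : realType} {d : nat}.

Definition dotp (x y : 'cV[R]_d) : R := \sum_j x j 0 * y j 0.

(* The library norm [`|x|] on matrices is the sup norm. It has the same
   topology, hence the same notion of differentiability, but Lipschitz
   constants depend on the norm. *)
Definition enorm (x : 'cV[R]_d) : R := Num.sqrt (dotp x x).

Definition grad (f : 'cV[R]_d -> R) (x : 'cV[R]_d) : 'cV[R]_d :=
  \col_j 'D_(delta_mx j 0) f x.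

Definition smooth (L : R) (f : 'cV[R]_d -> R) : Prop :=
  (forall x, differentiable f x) /\
  (forall x y, enorm (grad f x - grad f y) <= L * enorm (x - y)).

Definition convex (f : 'cV[R]_d -> R) : Prop := convex_function setT f.

End Euclidean.

Section Sampling.
Context {R : realType} {n : nat} {dsp : measure_display}
  {Omega : measurableType dsp} (P : probability Omega R).

Definition pr (E : set Omega) : R := fine (P E).

Implicit Type S : Omega -> {set 'I_n}.

Definition sampling S : Prop :=
  forall A : {set 'I_n}, measurable [set w | S w = A].

Definition inclusion_prob S (i : 'I_n) : R := pr [set w | i \in S w].

Definition proper_sampling S : Prop := forall i, 0 < inclusion_prob S i.

Definition nice_sampling S (tau : nat) : Prop :=
  (1 <= tau <= n)%N /\
  forall A : {set 'I_n},
    pr [set w | S w = A] = if #|A| == tau then 'C(n, tau)%:R^-1 else 0.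

(* [D] is the set of groups; the choice made in the group [C] is [S :&: C]. *)
Definition independent_groups S (D : {set {set 'I_n}}) : Prop :=
  forall (J : {set {set 'I_n}}) (B : {set 'I_n} -> {set 'I_n}),
    J \subset D ->
    pr [set w | forall C, C \in J -> S w :&: C = B C] =
    \prod_(C in J) pr [set w | S w :&: C = B C].

Definition group_choice S (q : 'I_n -> R) (C : {set 'I_n}) : Prop :=
  let s := \sum_(i in C) q i in
  [/\ pr [set w | #|S w :&: C| = 1%N] = s,
      pr [set w | S w :&: C = finset.set0] = 1 - s &
      forall i, i \in C ->
        pr [set w | S w :&: C = [set i]%SET] = s * (q i / s)].

Definition group_sampling S (q : 'I_n -> R) (D : {set {set 'I_n}}) : Prop :=
  [/\ forall i, 0 < q i <= 1,
      finset.partition D [set: 'I_n]%SET,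
      forall C, C \in D -> \sum_(i in C) q i <= 1,
      forall C, C \in D -> group_choice S q C &
      independent_groups S D].

Definition isolated_index (D : {set {set 'I_n}}) (i : 'I_n) : bool :=
  [set i]%SET \in D.

End Sampling.

Section ExpectedSmoothness.
Context {R : realType} {n d : nat}.

Definition average (F : 'I_n -> 'cV[R]_d -> R) (x : 'cV[R]_d) : R :=
  n%:R^-1 * \sum_i F i x.

Definition grad_mx (F : 'I_n -> 'cV[R]_d -> R) (x : 'cV[R]_d) : 'M[R]_(d, n) :=
  \matrix_(j, i) grad (F i) x j 0.

Definition weight_mx (theta : {set 'I_n} -> 'I_n -> R) (A : {set 'I_n})
  : 'M[R]_n := diag_mx (\row_i theta A i).

Definition indic_mx (A : {set 'I_n}) : 'M[R]_n :=
  diag_mx (\row_i (i \in A)%:R).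

Definition ones : 'cV[R]_n := const_mx 1.

Context {dsp : measure_display} {Omega : measurableType dsp}
  (P : probability Omega R).

Definition expected_smoothness (S : Omega -> {set 'I_n})
    (theta : {set 'I_n} -> 'I_n -> R) (F : 'I_n -> 'cV[R]_d -> R) : set R :=
  [set c | 0 <= c /\ forall x y : 'cV[R]_d,
    let G := grad_mx F x - grad_mx F y in
    let f := average F in
    ('E_P[fun w =>
       (enorm (n%:R^-1 *: (G *m weight_mx theta (S w) *m indic_mx (S w) *m ones)
               - n%:R^-1 *: (G *m ones)) ^+ 2)%R]
     <= (2 * c * (f x - f y - dotp (grad f y) (x - y)))%:E)%E].

Definition is_expected_smoothness_constant (S : Omega -> {set 'I_n})
    (theta : {set 'I_n} -> 'I_n -> R) (F : 'I_n -> 'cV[R]_d -> R) (c : R)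
    : Prop :=
  expected_smoothness S theta F c /\ lbound (expected_smoothness S theta F) c.

End ExpectedSmoothness.

(* The value over an empty range is [-oo], the neutral element of [maxe], so an
   empty maximum is omitted from an enclosing [maxe]. *)
Definition maximum {R : realType} {n : nat} (Q : pred 'I_n) (a : 'I_n -> R)
  : \bar R := \big[maxe/-oo%E]_(i < n | Q i) (a i)%:E.

(* Main.v *)
Require Import Defs.
From mathcomp Require Import all_boot all_order all_algebra.
From mathcomp Require Import all_classical all_reals all_analysis.
From mathcomp Require Import measurable_realfun.
From mathcomp Require Import ring lra.
Import Order.TTheory GRing.Theory Num.Theory.
Import numFieldNormedType.Exports.
Local Open Scope classical_set_scope.
Local Open Scope ring_scope.

(** The vector [n^-1 *: G theta_S I_S e - n^-1 *: G e] is [n^-1] times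
    [\sum_i (1_(i in S) / p_i - 1) a_i], with [a_i] the [i]-th column of [G].
    Since each coefficient has mean zero, the expected squared norm is [n^-2]
    times the quadratic form [\sum_i \sum_j K_ij <a_i, a_j>], where
    [K_ij = P(i, j in S) / (p_i p_j) - 1] is the covariance of the normalized
    indicators ([expectation_deviation]).

    Suppose this form is dominated by a diagonal one,
    [\sum_i w_i |a_i|^2] with [w_i >= 0]. For [a_i = grad F_i x - grad F_i y],
    convexity and [L_i]-smoothness of [F_i] give
    [|a_i|^2 <= 2 L_i (F_i x - F_i y - <grad F_i y, x - y>)]
    ([smooth_convex_bregman]); summing over [i], every [M >= 0] such that
    [w_i L_i <= n M] for all [i] is an admissible expected smoothness constant
    ([expected_smoothness_of_diagonal]). A smallest admissible constant then
    exists, because admissibility is a closed condition, and it is at most [M].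

    It remains to dominate the covariance form.
    - For the [tau]-nice sampling, [K_ij = k (n 1_(i = j) - 1)] with
      [k = (n - tau) / (tau (n - 1))], so that the form equals
      [k (n \sum_i |a_i|^2 - |\sum_i a_i|^2)], and [w_i = k n] works.
    - For a group sampling, [K_ij] vanishes when [i] and [j] lie in distinct
      groups (independence), equals [-1] for distinct [i] and [j] in one group
      (at most one index is chosen there), and [K_ii = 1 / p_i - 1]. The form is
      therefore [\sum_i |a_i|^2 / p_i - \sum_C |\sum_(i in C) a_i|^2], the last
      sum running over the groups. A singleton group contributes exactly its
      [|a_i|^2] to that sum, and the other groups contribute something
      nonnegative, so [w_i = 1 / p_i - 1] works for an isolated [i] and
      [w_i = 1 / p_i] for the others. *)

(** * Convex smooth functions on Euclidean space *)

Section EuclideanTheory.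
Context {R : realType} {d : nat}.
Implicit Types (x y z : 'cV[R]_d) (f : 'cV[R]_d -> R).

Lemma dotpC x y : dotp x y = dotp y x.
Proof. by apply: eq_bigr => j _; rewrite mulrC. Qed.

Lemma dotpDr x y z : dotp x (y + z) = dotp x y + dotp x z.
Proof. by rewrite -big_split; apply: eq_bigr => j _; rewrite !mxE mulrDr. Qed.

Lemma dotpZr (c : R) x y : dotp x (c *: y) = c * dotp x y.
Proof. by rewrite mulr_sumr; apply: eq_bigr => j _; rewrite !mxE mulrCA. Qed.

Lemma dotpBr x y z : dotp x (y - z) = dotp x y - dotp x z.
Proof. by rewrite -scaleN1r dotpDr dotpZr mulN1r. Qed.

Lemma dotpBl x y z : dotp (x - y) z = dotp x z - dotp y z.
Proof. by rewrite dotpC dotpBr !(dotpC z). Qed.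

Lemma dotpZl (c : R) x y : dotp (c *: x) y = c * dotp x y.
Proof. by rewrite dotpC dotpZr dotpC. Qed.

Lemma dotp_sumr (I : Type) (r : seq I) (Q : pred I) x (a : I -> 'cV[R]_d) :
  dotp x (\sum_(i <- r | Q i) a i) = \sum_(i <- r | Q i) dotp x (a i).
Proof.
rewrite exchange_big; apply: eq_bigr => j _.
by rewrite summxE mulr_sumr.
Qed.

Lemma dotp_suml (I : Type) (r : seq I) (Q : pred I) x (a : I -> 'cV[R]_d) :
  dotp (\sum_(i <- r | Q i) a i) x = \sum_(i <- r | Q i) dotp (a i) x.
Proof. by rewrite dotpC dotp_sumr; apply: eq_bigr => i _; rewrite dotpC. Qed.

Lemma dotp_ge0 x : 0 <= dotp x x.
Proof. by apply: sumr_ge0 => j _; rewrite -expr2 sqr_ge0. Qed.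

Lemma enorm_ge0 x : 0 <= enorm x.
Proof. exact: sqrtr_ge0. Qed.

Lemma sqr_enorm x : enorm x ^+ 2 = dotp x x.
Proof. by rewrite sqr_sqrtr // dotp_ge0. Qed.

Lemma enormZ (c : R) x : 0 <= c -> enorm (c *: x) = c * enorm x.
Proof.
move=> c0; rewrite /enorm dotpZl dotpZr mulrA -expr2.
by rewrite sqrtrM ?sqr_ge0// sqrtr_sqr ger0_norm.
Qed.

Lemma enorm0_dotp x y : enorm x = 0 -> dotp x y = 0.
Proof.
move=> x0; have xx0 : dotp x x = 0 by rewrite -sqr_enorm x0 expr0n.
have /psumr_eq0P : forall k : 'I_d, true -> 0 <= x k 0 * x k 0.
  by move=> k _; rewrite -expr2 sqr_ge0.
move=> /(_ xx0) x2; apply: big1 => j _.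
by have /eqP := x2 j isT; rewrite mulf_eq0 orbb => /eqP ->; rewrite mul0r.
Qed.

(** The Cauchy-Schwarz inequality. *)
Lemma dotp_le_enorm x y : dotp x y <= enorm x * enorm y.
Proof.
have [x0|x0] := eqVneq (enorm x) 0; first by rewrite enorm0_dotp // x0 mul0r.
have [y0|y0] := eqVneq (enorm y) 0.
  by rewrite dotpC enorm0_dotp // y0 mulr0.
have xgt0 : 0 < enorm x by rewrite lt_neqAle eq_sym x0 enorm_ge0.
have ygt0 : 0 < enorm y by rewrite lt_neqAle eq_sym y0 enorm_ge0.
have := dotp_ge0 (enorm y *: x - enorm x *: y).
rewrite dotpBl !dotpBr !dotpZl !dotpZr -!sqr_enorm (dotpC y x).
set s := dotp x y => h.
have h2 : 0 <= (2 * (enorm x * enorm y)) * (enorm x * enorm y - s).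
  apply: le_trans h _; rewrite le_eqVlt; apply/orP; left; apply/eqP; ring.
by move: h2; rewrite pmulr_rge0 ?subr_ge0 // !mulr_gt0.
Qed.

Lemma derive_grad f x (h : 'cV[R]_d) :
  differentiable f x -> 'D_h f x = dotp (grad f x) h.
Proof.
move=> fx; rewrite deriveE // {1}(matrix_sum_delta h) linear_sum.
apply: eq_bigr => j _; rewrite linear_sum big_ord1 linearZ /=.
by rewrite !mxE deriveE // mulrC.
Qed.

(** The derivative of [f] along the line [s |-> x + s *: h]. *)
Lemma is_derive_line f x (h : 'cV[R]_d) (t : R) :
  (forall z, differentiable f z) ->
  is_derive t (1 : R) (fun s : R => f (x + s *: h))
    (dotp (grad f (x + t *: h)) h).
Proof.
move=> df.
have E : (fun s : R => s^-1 *: (((fun s => f (x + s *: h)) \o shift t)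
               (s *: (1 : R)) - f (x + t *: h)))
    = (fun s : R => s^-1 *: ((f \o shift (x + t *: h)) (s *: h)
               - f (x + t *: h))).
  apply/funext => s /=; congr (_ *: (f _ - _)).
  by rewrite [s *: _]mulr1 scalerDl addrCA.
split; first by rewrite /derivable E; apply: diff_derivable.
by rewrite /derive E -derive_grad.
Qed.

(** A differentiable convex function lies above its tangent hyperplanes. *)
Lemma convex_ge_tangent f x y : (forall z, differentiable f z) -> convex f ->
  f y + dotp (grad f y) (x - y) <= f x.
Proof.
move=> df cf; rewrite -lerBrDl -derive_grad //.
have dv : derivable f y (x - y) by exact: diff_derivable.
have cv : h^-1 *: ((f \o shift y) (h *: (x - y)) - f y) @[h --> 0^'+]
    --> 'D_(x - y) f y.
  exact: cvg_dnbhs_at_right.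
rewrite -(cvg_lim _ cv) //; apply: limr_le.
  by apply/cvg_ex; exists ('D_(x - y) f y).
near=> h.
have h0 : 0 < h by near: h; apply: nbhs_right_gt.
have h1 : h <= 1 by near: h; apply: nbhs_right_le.
have /(_ x y) := cf (Itv01 (ltW h0) h1); rewrite !inE => /(_ Logic.I Logic.I).
rewrite convRE /= /conv /= /unstable.onem => fh.
rewrite [_ *: _]mulrC ler_pdivrMr //.
have -> : h *: (x - y) + y = h *: x + (1 - h) *: y.
  by rewrite scalerBl scale1r scalerBr -addrA (addrC y).
apply: le_trans (lerB fh (lexx _)) _.
by rewrite le_eqVlt; apply/orP; left; apply/eqP; ring.
Unshelve. all: by end_near.
Qed.

(** The descent lemma: an [L]-smooth function lies below the quadratic
    [f x + <grad f x, h> + L / 2 * |h|^2]. *)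
Lemma smooth_le_quadratic L f x (h : 'cV[R]_d) : smooth L f ->
  f (x + h) <= f x + dotp (grad f x) h + L / 2 * dotp h h.
Proof.
move=> [df lip].
pose psi (t : R) := f (x + t *: h) - t * dotp (grad f x) h
  - t ^+ 2 * (L / 2 * dotp h h).
pose dpsi (t : R) := dotp (grad f (x + t *: h)) h - dotp (grad f x) h
  - (2 * t) * (L / 2 * dotp h h).
have dpsiP t : is_derive t (1 : R) psi (dpsi t).
  have := is_derive_line _ x h t df => D1.
  apply: is_derive_eq; rewrite /dpsi /GRing.scale /=; ring.
have psic : {within `[(0 : R), 1], continuous psi}.
  by apply: derivable_within_continuous => t _; have [] := dpsiP t.
have [c c01 E] := MVT ltr01 (fun t _ => dpsiP t) psic.
have c0 : 0 <= c by move: c01; rewrite in_itv /= => /andP[/ltW].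
suff : dpsi c <= 0.
  rewrite subr0 mulr1 in E; rewrite -E /psi !scale1r !scale0r addr0 !mul1r !mul0r.
  by rewrite expr1n expr0n /= !mul0r mul1r; lra.
rewrite /dpsi -dotpBl.
have -> : 2 * c * (L / 2 * dotp h h) = L * c * dotp h h by field.
rewrite subr_le0; apply: le_trans (dotp_le_enorm _ _) _.
rewrite -sqr_enorm expr2 mulrA ler_wpM2r ?enorm_ge0 //.
by have := lip (x + c *: h) x; rewrite addrAC subrr add0r enormZ // mulrA.
Qed.

(** In dimension zero the Lipschitz condition is void, hence the hypothesis on
    [d]. *)
Lemma smooth_ge0 L f : (0 < d)%N -> smooth L f -> 0 <= L.
Proof.
move=> d0 [_ lip].
have e1 : enorm (delta_mx (Ordinal d0) 0 - 0 : 'cV[R]_d) = 1.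
  rewrite subr0 /enorm /dotp (bigD1 (Ordinal d0)) //= big1 => [|j /negPf j0].
    by rewrite !mxE !eqxx mulr1 addr0 sqrtr1.
  by rewrite !mxE j0 mul0r.
by rewrite -[L in 0 <= L]mulr1 -e1; exact: le_trans (enorm_ge0 _) (lip _ _).
Qed.

(** The Bregman divergence [f x - f y - <grad f y, x - y>] of an [L]-smooth
    convex function controls the squared distance between gradients. *)
Lemma smooth_convex_bregman L f x y : 0 <= L -> smooth L f -> convex f ->
  enorm (grad f x - grad f y) ^+ 2
    <= 2 * L * (f x - f y - dotp (grad f y) (x - y)).
Proof.
move=> L0 sf cf; have [df lip] := sf.
have [L00|Ln0] := eqVneq L 0.
  have := lip x y; rewrite L00 mul0r mulr0 mul0r => g0.
  by rewrite expr2 mulr_ge0_le0 // enorm_ge0.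
have Lp : 0 < L by rewrite lt_neqAle eq_sym Ln0.
set g := grad f x - grad f y.
(* [x + h] is one gradient step from [x], of step size [1 / L], for the
   function [f - <grad f y, .>], whose minimum is attained at [y]. *)
pose h := - L^-1 *: g.
(* The tangent at [y] bounds [f (x + h)] from below, the descent lemma at [x]
   from above. *)
have := le_trans (convex_ge_tangent _ (x + h) y df cf)
  (smooth_le_quadratic _ _ x h sf).
have -> : x + h - y = (x - y) + h by rewrite addrAC.
rewrite dotpDr sqr_enorm => H.
have gh : dotp (grad f x) h - dotp (grad f y) h = - L^-1 * dotp g g.
  by rewrite -dotpBl dotpZr.
have hh : L / 2 * dotp h h = (2 * L)^-1 * dotp g g.
  by rewrite dotpZl dotpZr; field.
rewrite hh in H.
rewrite -ler_pdivrMl ?mulr_gt0 //.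
have E : (2 * L)^-1 * dotp g g = L^-1 * dotp g g - (2 * L)^-1 * dotp g g by field.
rewrite {}E; lra.
Qed.

End EuclideanTheory.

(** * The finite law of a sampling *)

Section FiniteLaw.
Context {R : realType} {n : nat} {dsp : measure_display}
  {Omega : measurableType dsp} (P : probability Omega R)
  (S : Omega -> {set 'I_n}).
Context (hS : sampling S).

(** The law of a random subset, as a weight function on the finite type of
    subsets. *)
Definition law (A : {set 'I_n}) : R := pr P [set w | S w = A].

Lemma law_ge0 A : 0 <= law A.
Proof. by rewrite /law /pr fine_ge0. Qed.

Lemma EFin_law A : (law A)%:E = P [set w | S w = A].
Proof. by rewrite /law /pr fineK // fin_num_measure //; apply: hS. Qed.

Lemma expectation_sampling (g : {set 'I_n} -> R) : (forall A, 0 <= g A) ->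
  ('E_P[fun w => g (S w)])%E = (\sum_A law A * g A)%:E.
Proof.
move=> g0; rewrite unlock.
transitivity (\int[P]_w (\sum_A ((g A)%:E * (\1_[set w | S w = A] w)%:E)))%E.
  apply: eq_integral => w _; rewrite (bigD1 (S w)) //= big1 => [|A ASw].
    by rewrite adde0 indicE mem_set // mule1.
  by rewrite indicE memNset ?mule0 //= => E; rewrite E eqxx in ASw.
rewrite ge0_integral_sum //; last 2 first.
- move=> A; apply: measurable_funeM; apply/measurable_EFinP.
  by apply: measurable_indic; exact: hS.
- by move=> A w _; rewrite mule_ge0 // ?lee_fin.
rewrite -sumEFin; apply: eq_bigr => A _.
rewrite ge0_integralZl_EFin //.
- by rewrite integral_indic // setIT EFinM EFin_law muleC.
- by apply/measurable_EFinP; apply: measurable_indic; exact: hS.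
Qed.

Lemma measurable_sampling_event (Q : pred {set 'I_n}) :
  measurable [set w | Q (S w)].
Proof.
rewrite (_ : [set w | Q (S w)] = \bigcup_(A in [set A | Q A]) [set w | S w = A]).
  by apply: fin_bigcup_measurable => // A _; exact: hS.
by apply/seteqP; split => [w Qw|w [A QA /= ->]] //; exists (S w).
Qed.

Lemma pr_samplingE (Q : pred {set 'I_n}) :
  pr P [set w | Q (S w)] = \sum_(A | Q A) law A.
Proof.
rewrite /pr -expectation_indic; last exact: measurable_sampling_event.
have -> : \1_[set w | Q (S w)] = (fun w => (Q (S w))%:R) :> (Omega -> R).
  by apply/funext => w; rewrite indicE; congr ((nat_of_bool _)%:R); apply/idP/idP;
    rewrite inE.
rewrite (expectation_sampling (fun A => (Q A)%:R)) => [|A]; last exact: ler0n.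
by rewrite /= [RHS]big_mkcond; apply: eq_bigr => A _; rewrite mulr_natr mulrb.
Qed.

Lemma sum_law : \sum_A law A = 1.
Proof.
rewrite -(pr_samplingE predT) /pr.
by rewrite (_ : [set w | predT (S w)] = setT) ?probability_setT // -subTset.
Qed.

Lemma inclusion_probE i :
  inclusion_prob P S i = \sum_(A : {set 'I_n} | i \in A) law A.
Proof. exact: pr_samplingE. Qed.

Lemma inclusion_prob_le1 i : inclusion_prob P S i <= 1.
Proof.
rewrite inclusion_probE -sum_law.
rewrite [X in _ <= X](bigID (fun A : {set 'I_n} => i \in A)) lerDl.
by apply: sumr_ge0 => A _; exact: law_ge0.
Qed.

(** The probability that a sampling picks both [i] and [j]. *)
Definition pair_prob (i j : 'I_n) : R :=
  \sum_(A : {set 'I_n} | (i \in A) && (j \in A)) law A.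

Lemma pair_probii i : pair_prob i i = inclusion_prob P S i.
Proof. by rewrite inclusion_probE; apply: eq_bigl => A; rewrite andbb. Qed.

(** The covariance of the normalized indicators [1_(i in S) / p_i] and
    [1_(j in S) / p_j], both of which have mean [1]. *)
Definition indicator_cov (i j : 'I_n) : R :=
  pair_prob i j / (inclusion_prob P S i * inclusion_prob P S j) - 1.

Lemma indicator_covE i j :
  inclusion_prob P S i != 0 -> inclusion_prob P S j != 0 ->
  \sum_(A : {set 'I_n}) law A * (((i \in A)%:R / inclusion_prob P S i - 1)
    * ((j \in A)%:R / inclusion_prob P S j - 1)) = indicator_cov i j.
Proof.
move=> pi0 pj0.
have EI (Q : pred {set 'I_n}) : \sum_A law A * (Q A)%:R = \sum_(A | Q A) law A.
  by rewrite [RHS]big_mkcond; apply: eq_bigr => A _; rewrite mulr_natr mulrb.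
have Ei k := EI (fun A => k \in A).
have Eij := EI (fun A => (i \in A) && (j \in A)).
set p := inclusion_prob P S in pi0 pj0 *.
transitivity ((p i * p j)^-1 * (\sum_A law A * ((i \in A) && (j \in A))%:R)
   - (p i)^-1 * (\sum_A law A * (i \in A)%:R)
   - (p j)^-1 * (\sum_A law A * (j \in A)%:R) + \sum_A law A).
  rewrite !mulr_sumr -!sumrB -big_split; apply: eq_bigr => A _ /=.
  by rewrite -mulnb natrM invfM; ring.
rewrite Eij !Ei -!inclusion_probE sum_law -/p !mulVf // /indicator_cov -/p.
by rewrite mulrC addrNK.
Qed.

End FiniteLaw.

(** * The deviation of the reweighted sample sum *)

Section Deviation.
Context {R : realType} {n d : nat}.

Lemma deviationE (G : 'M[R]_(d, n)) (theta : {set 'I_n} -> 'I_n -> R)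
    (A : {set 'I_n}) :
  n%:R^-1 *: (G *m weight_mx theta A *m indic_mx A *m ones)
    - n%:R^-1 *: (G *m ones)
  = n%:R^-1 *: \sum_i ((i \in A)%:R * theta A i - 1) *: col i G.
Proof.
rewrite -scalerBr; congr (_ *: _); apply/colP => k.
rewrite summxE !mxE -sumrB; apply: eq_bigr => i _.
rewrite /weight_mx /indic_mx !mul_mx_diag !mxE; ring.
Qed.

Lemma grad_average (F : 'I_n -> 'cV[R]_d -> R) y :
  (forall i, differentiable (F i) y) ->
  grad (average F) y = n%:R^-1 *: \sum_i grad (F i) y.
Proof.
move=> dF; apply/colP => k; rewrite !mxE summxE.
have -> : average F = n%:R^-1 *: \sum_i F i :> ('cV[R]_d -> R).
  by apply/funext => x; rewrite /average fctE fct_sumE.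
have dk i : derivable (F i) y (delta_mx k 0) by exact: diff_derivable.
rewrite deriveZ; last by apply: derivable_sum.
rewrite derive_sum //; congr (_ * _).
by apply: eq_bigr => i _; rewrite mxE.
Qed.

Lemma bregman_average (F : 'I_n -> 'cV[R]_d -> R) x y :
  (forall i, differentiable (F i) y) ->
  average F x - average F y - dotp (grad (average F) y) (x - y)
  = n%:R^-1 * \sum_i (F i x - F i y - dotp (grad (F i) y) (x - y)).
Proof.
move=> dF; rewrite grad_average // dotpZl dotp_suml /average -!mulrBr.
by rewrite -!sumrB.
Qed.

Context {dsp : measure_display} {Omega : measurableType dsp}
  (P : probability Omega R) (S : Omega -> {set 'I_n}).
Context (hS : sampling S).
Context (hproper : proper_sampling P S).
Let p := inclusion_prob P S.
Let theta := fun (A : {set 'I_n}) (i : 'I_n) => 1 / p i.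

(** The mean squared deviation of the reweighted sample sum from the full sum
    is a quadratic form whose matrix is the covariance of the indicators. *)
Lemma expectation_deviation (G : 'M[R]_(d, n)) :
  ('E_P[fun w =>
     (enorm (n%:R^-1 *: (G *m weight_mx theta (S w) *m indic_mx (S w) *m ones)
             - n%:R^-1 *: (G *m ones)) ^+ 2)%R])%E
  = (n%:R^-1 ^+ 2 * \sum_i \sum_j
       indicator_cov P S i j * dotp (col i G) (col j G))%:E.
Proof.
rewrite (expectation_sampling P S hS (fun A => enorm (n%:R^-1 *:
  (G *m weight_mx theta A *m indic_mx A *m ones) - n%:R^-1 *: (G *m ones)) ^+ 2));
  last by move=> A; rewrite sqr_ge0.
congr (_%:E).
have p0 i : p i != 0 by rewrite gt_eqF // hproper.
transitivity (n%:R^-1 ^+ 2 * \sum_A \sum_i \sum_j law P S A *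
   (((i \in A)%:R / p i - 1) * ((j \in A)%:R / p j - 1)) *
   dotp (col i G) (col j G)).
  rewrite mulr_sumr; apply: eq_bigr => A _.
  rewrite deviationE sqr_enorm dotpZl dotpZr [n%:R^-1 * _]mulrA -expr2 mulrCA.
  congr (_ * _).
  rewrite dotp_suml mulr_sumr; apply: eq_bigr => i _.
  rewrite dotp_sumr mulr_sumr; apply: eq_bigr => j _.
  by rewrite dotpZl dotpZr /theta; ring.
rewrite exchange_big /=; congr (_ * _); apply: eq_bigr => i _.
rewrite exchange_big /=; apply: eq_bigr => j _.
by rewrite -mulr_suml indicator_covE.
Qed.

(** If the covariance form is dominated by the diagonal form with weights [w],
    the gradient inequality of each smooth convex [F i] makes any [M >= 0]
    with [w i * L i <= n * M] an expected smoothness constant. *)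
Lemma expected_smoothness_of_diagonal (F : 'I_n -> 'cV[R]_d -> R)
    (L w : 'I_n -> R) (M : R) : (0 < n)%N ->
  (forall i, smooth (L i) (F i)) -> (forall i, convex (F i)) ->
  (forall i, 0 <= L i) -> (forall i, 0 <= w i) -> 0 <= M ->
  (forall i, w i * L i <= n%:R * M) ->
  (forall a : 'I_n -> 'cV[R]_d,
     \sum_i \sum_j indicator_cov P S i j * dotp (a i) (a j)
       <= \sum_i w i * dotp (a i) (a i)) ->
  expected_smoothness P S theta F M.
Proof.
move=> n0 sF cF L0 w0 M0 wM hcov; split => // x y /=.
have nR : 0 < n%:R :> R by rewrite ltr0n.
rewrite expectation_deviation lee_fin.
rewrite bregman_average; last by move=> i; have [] := sF i.
set B := fun i => F i x - F i y - dotp (grad (F i) y) (x - y).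
have B0 i : 0 <= B i.
  have [df _] := sF i; have := convex_ge_tangent _ x y df (cF i).
  by rewrite /B; lra.
have colG i : col i (grad_mx F x - grad_mx F y) = grad (F i) x - grad (F i) y.
  by apply/colP => k; rewrite !mxE.
rewrite [X in _ <= X](_ : _ =
    n%:R^-1 ^+ 2 * \sum_i (n%:R * M) * (2 * B i)); last first.
  by rewrite -mulr_sumr -mulr_sumr; field; rewrite gt_eqF.
rewrite ler_wpM2l ?sqr_ge0 //; apply: le_trans (hcov _) _.
apply: ler_sum => i _; rewrite colG -sqr_enorm.
apply: (@le_trans _ _ (w i * (2 * L i * B i))).
  by rewrite ler_wpM2l //; apply: smooth_convex_bregman.
have -> : w i * (2 * L i * B i) = (w i * L i) * (2 * B i) by ring.
by rewrite ler_wpM2r // mulr_ge0.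
Qed.

(** The defining conditions on the constant are closed, so the smallest
    admissible constant exists as soon as one is admissible. *)
Lemma expected_smoothness_constant_exists (F : 'I_n -> 'cV[R]_d -> R) (M : R) :
  (forall x, differentiable (average F) x) -> convex (average F) ->
  expected_smoothness P S theta F M ->
  exists2 c, is_expected_smoothness_constant P S theta F c & c <= M.
Proof.
move=> df cf hM; set C := expected_smoothness P S theta F in hM *.
have lbC : has_lbound C by exists 0 => c [].
have C0 : C !=set0 by exists M.
exists (inf C); last exact: ge_inf.
split; last by move=> c hc; exact: ge_inf.
split; first by apply: lb_le_inf => // c [].
move=> x y /=; have := hM.2 x y; rewrite /= expectation_deviation !lee_fin.
set e := n%:R^-1 ^+ 2 * _.
set B := average F x - _ - _ => eM.
have B0 : 0 <= B by have := convex_ge_tangent _ x y df cf; rewrite /B; lra.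
have [B00|Bn0] := eqVneq B 0; first by move: eM; rewrite B00 !mulr0.
have Bp : 0 < 2 * B by rewrite mulr_gt0 // lt_neqAle eq_sym Bn0.
have H c : (e <= 2 * c * B) = (e / (2 * B) <= c).
  by rewrite ler_pdivrMr // (_ : 2 * c * B = c * (2 * B)) //; ring.
(* [e / (2 * B)] is a lower bound of all admissible constants. *)
rewrite H; apply: lb_le_inf => // c hc; rewrite -H.
by have := hc.2 x y; rewrite /= expectation_deviation lee_fin.
Qed.

End Deviation.

(** * Nice samplings *)

Section NiceSampling.
Context {R : realType} {n : nat} {dsp : measure_display}
  {Omega : measurableType dsp} (P : probability Omega R)
  (S : Omega -> {set 'I_n}) (tau : nat).
Context (hS : sampling S).
Context (n2 : (2 <= n)%N).
Context (nice : nice_sampling P S tau).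

(** The probability that a [tau]-nice sampling avoids a given set [B]. *)
Lemma nice_avoid (B : {set 'I_n}) :
  \sum_(A : {set 'I_n} | A \subset ~: B) law P S A
  = 'C(n - #|B|, tau)%:R / 'C(n, tau)%:R.
Proof.
have [_ lawE] := nice.
transitivity (\sum_(A in [set A : {set 'I_n} | A \subset ~: B & #|A| == tau]%SET)
    'C(n, tau)%:R^-1 : R).
  rewrite [RHS](eq_bigl
      (fun A : {set 'I_n} => (A \subset ~: B) && (#|A| == tau)));
    last by move=> A; rewrite inE.
  by rewrite big_mkcondr; apply: eq_bigr => A _; rewrite /law lawE.
rewrite sumr_const cards_draws [#|~: B|]cardsCs finset.setCK card_ord.
by rewrite mulr_natl.
Qed.

Lemma nice_avoid1 i :
  \sum_(A : {set 'I_n} | i \notin A) law P S A = (n%:R - tau%:R) / n%:R.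
Proof.
have [/andP[_ taun] _] := nice.
have n0 : n%:R != 0 :> R by rewrite pnatr_eq0 -lt0n ltnW.
have C0 : 'C(n, tau)%:R != 0 :> R by rewrite pnatr_eq0 -lt0n bin_gt0.
have := nice_avoid [set i]%SET; rewrite cards1 subn1.
rewrite (eq_bigl (fun A : {set 'I_n} => i \notin A)) => [->|A]; last first.
  by rewrite finset.subsetC finset.sub1set inE.
have /(congr1 (fun k : nat => k%:R : R)) := mul_bin_down n tau.
rewrite !natrM natrB // => E.
by apply/eqP; rewrite eqr_div // mulrC E.
Qed.

Lemma nice_avoid2 i j : i != j ->
  \sum_(A : {set 'I_n} | (i \notin A) && (j \notin A)) law P S A
  = (n%:R - tau%:R) * (n%:R - 1 - tau%:R) / (n%:R * (n%:R - 1)).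
Proof.
move=> ij; have [/andP[_ taun] _] := nice.
have n0 : n%:R != 0 :> R by rewrite pnatr_eq0 -lt0n ltnW.
have n10 : n%:R - 1 != 0 :> R by rewrite subr_eq0 pnatr_eq1 gtn_eqF.
have C0 : 'C(n, tau)%:R != 0 :> R by rewrite pnatr_eq0 -lt0n bin_gt0.
have := nice_avoid [set i; j]%SET; rewrite cards2 ij.
rewrite (eq_bigl (fun A : {set 'I_n} => (i \notin A) && (j \notin A)));
  last by move=> A; rewrite finset.subsetC finset.subUset !finset.sub1set !inE.
move=> ->.
have n1R : n.-1%:R = n%:R - 1 :> R by rewrite -subn1 natrB // ltnW.
have E1 : n%:R * 'C(n.-1, tau)%:R = (n%:R - tau%:R) * 'C(n, tau)%:R :> R.
  by rewrite -natrM mul_bin_down natrM natrB.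
have E2 : (n%:R - 1) * 'C(n.-2, tau)%:R
    = (n.-1 - tau)%N%:R * 'C(n.-1, tau)%:R :> R.
  by rewrite -n1R -!natrM mul_bin_down.
have E3 : (n.-1 - tau)%N%:R * 'C(n.-1, tau)%:R
    = (n%:R - 1 - tau%:R) * 'C(n.-1, tau)%:R :> R.
  (* For [tau = n] the subtraction truncates, and the binomial vanishes. *)
  have [le|lt] := leqP tau n.-1; first by rewrite natrB // n1R.
  by rewrite bin_small ?mulr0.
apply/eqP; rewrite eqr_div ?mulf_neq0 //; apply/eqP.
transitivity (n%:R * ((n%:R - 1) * 'C(n.-2, tau)%:R) : R).
  by rewrite subn2; ring.
rewrite E2 E3.
transitivity ((n%:R - 1 - tau%:R) * (n%:R * 'C(n.-1, tau)%:R) : R); first ring.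
by rewrite E1; ring.
Qed.

Lemma nice_inclusion_prob i : inclusion_prob P S i = tau%:R / n%:R.
Proof.
have n0 : n%:R != 0 :> R by rewrite pnatr_eq0 -lt0n ltnW.
have := sum_law P S hS; rewrite (bigID (fun A : {set 'I_n} => i \in A)) /=.
rewrite -inclusion_probE // nice_avoid1 => /eqP; rewrite -subr_eq0 => /eqP E.
by apply/eqP; rewrite -subr_eq0 -E; apply/eqP; field.
Qed.

Lemma nice_pair_prob i j : i != j ->
  pair_prob P S i j = (tau%:R * (tau%:R - 1)) / (n%:R * (n%:R - 1)).
Proof.
move=> ij.
have n0 : n%:R != 0 :> R by rewrite pnatr_eq0 -lt0n ltnW.
have n10 : n%:R - 1 != 0 :> R by rewrite subr_eq0 pnatr_eq1 gtn_eqF.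
(* Inclusion-exclusion: splitting the event [j notin S] according to [i], then
   the event [i in S] according to [j]. *)
have := nice_avoid1 j; rewrite (bigID (fun A : {set 'I_n} => i \in A)) /=.
rewrite [X in _ + X](eq_bigl (fun A : {set 'I_n} => (i \notin A) && (j \notin A)));
  last by move=> A; rewrite andbC.
rewrite nice_avoid2 // => E1.
have := inclusion_probE P S hS i.
rewrite nice_inclusion_prob (bigID (fun A : {set 'I_n} => j \in A)) /=.
rewrite [X in _ + X](eq_bigl (fun A : {set 'I_n} => (j \notin A) && (i \in A)));
  last by move=> A; rewrite andbC.
rewrite -/(pair_prob P S i j) => E2.
move/(canRL (addrK _)): E1 => E1; rewrite E1 in E2.
by move/esym/(canRL (addrK _)): E2 => ->; field; rewrite n0 n10.
Qed.

Lemma nice_indicator_cov i j :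
  indicator_cov P S i j = (n%:R - tau%:R) / (tau%:R * (n%:R - 1))
    * (n%:R * (i == j)%:R - 1).
Proof.
have [/andP[tau1 taun] _] := nice.
have n0 : n%:R != 0 :> R by rewrite pnatr_eq0 -lt0n ltnW.
have n10 : n%:R - 1 != 0 :> R by rewrite subr_eq0 pnatr_eq1 gtn_eqF.
have t0 : tau%:R != 0 :> R by rewrite pnatr_eq0 -lt0n.
rewrite /indicator_cov; have [<-|ij] := eqVneq i j.
  by rewrite pair_probii // !nice_inclusion_prob mulr1; field; rewrite n0 n10 t0.
by rewrite nice_pair_prob // !nice_inclusion_prob mulr0; field; rewrite n0 n10 t0.
Qed.

(** The difference of the two sides is a nonnegative multiple of the squared
    norm of [\sum_i a i]. *)
Lemma nice_cov_form (d : nat) (a : 'I_n -> 'cV[R]_d) :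
  \sum_i \sum_j indicator_cov P S i j * dotp (a i) (a j)
  <= \sum_i ((n%:R - tau%:R) / (tau%:R * (n%:R - 1)) * n%:R) * dotp (a i) (a i).
Proof.
have [/andP[tau1 taun] _] := nice.
set k := _ / _.
have k0 : 0 <= k.
  by rewrite divr_ge0 ?mulr_ge0 ?subr_ge0 ?ler_nat ?ler1n // ltnW.
rewrite -subr_ge0; set Q := _ - _.
suff -> : Q = k * dotp (\sum_i a i) (\sum_i a i) by rewrite mulr_ge0 // dotp_ge0.
rewrite /Q dotp_suml mulr_sumr -sumrB; apply: eq_bigr => i _.
rewrite dotp_sumr [RHS]mulr_sumr.
transitivity (\sum_j ((k * n%:R) * ((i == j)%:R * dotp (a i) (a j))
    - indicator_cov P S i j * dotp (a i) (a j))).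
  rewrite sumrB; congr (_ - _).
  rewrite [RHS](bigD1 i) //= eqxx mul1r [X in _ + X]big1 ?addr0 // => j /negPf ji.
  by rewrite eq_sym ji mul0r mulr0.
by apply: eq_bigr => j _; rewrite nice_indicator_cov -/k; ring.
Qed.

End NiceSampling.

(** * Group samplings *)

Section GroupSampling.
Context {R : realType} {n : nat} {dsp : measure_display}
  {Omega : measurableType dsp} (P : probability Omega R)
  (S : Omega -> {set 'I_n}) (q : 'I_n -> R) (D : {set {set 'I_n}}).
Context (hS : sampling S).
Context (hproper : proper_sampling P S).
Context (group : group_sampling P S q D).

(** Almost surely at most one index is chosen from each group. *)
Lemma group_law_eq0 (C A : {set 'I_n}) : C \in D -> (1 < #|A :&: C|)%N ->
  law P S A = 0.
Proof.
have [_ _ _ choice _] := group; move=> CD AC.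
have [one none _] := choice C CD.
have := sum_law P S hS.
rewrite (bigID (fun A : {set 'I_n} => #|A :&: C| == 1%N)) /=.
rewrite [X in _ + X](bigID (fun A : {set 'I_n} => A :&: C == finset.set0)) /=.
rewrite -(pr_samplingE P S hS (fun A => #|A :&: C| == 1%N)).
rewrite (_ : [set w | _] = [set w | #|S w :&: C| = 1%N]); last first.
  by apply/seteqP; split=> w /= /eqP.
rewrite one.
rewrite (eq_bigl (fun A : {set 'I_n} => A :&: C == finset.set0)); last first.
  move=> B /=; have [->|] := eqVneq (B :&: C) finset.set0.
    by rewrite cards0.
  by rewrite andbF.
rewrite -(pr_samplingE P S hS (fun A => A :&: C == finset.set0)).
rewrite (_ : [set w | _] = [set w | S w :&: C = finset.set0]); last first.
  by apply/seteqP; split=> w /= /eqP.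
rewrite none addrCA addrA addrNK -[RHS]addr0 => /addrI E.
apply: (psumr_eq0P _ E) => [B _|]; first exact: law_ge0.
by rewrite gtn_eqF //= -cards_eq0 gtn_eqF // ltnW.
Qed.

(** Outside a null event, the choice made in the group of [i] is [i] exactly
    when [i] is sampled. *)
Lemma group_setI1 (C A : {set 'I_n}) i : C \in D -> i \in C ->
  law P S A != 0 -> (A :&: C == [set i]%SET) = (i \in A).
Proof.
move=> CD iC lA; apply/eqP/idP => [E|iA].
  by have := finset.set11 i; rewrite -E inE => /andP[].
apply/esym/eqP; rewrite eqEcard finset.sub1set inE iA iC cards1 /= leqNgt.
by apply: contra lA => /(group_law_eq0 _ _ CD) ->.
Qed.

Lemma pr_group_setI1 (C : {set 'I_n}) i : C \in D -> i \in C ->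
  pr P [set w | S w :&: C = [set i]%SET] = inclusion_prob P S i.
Proof.
move=> CD iC; rewrite inclusion_probE //.
rewrite (_ : [set w | _] = [set w | S w :&: C == [set i]%SET]); last first.
  by apply/seteqP; split=> w /= /eqP.
rewrite (pr_samplingE P S hS (fun A => A :&: C == [set i]%SET)).
rewrite big_mkcond [RHS]big_mkcond; apply: eq_bigr => A _.
have [->|lA] := eqVneq (law P S A) 0; first by rewrite !if_same.
by rewrite group_setI1.
Qed.

Lemma group_pair_prob_same (C : {set 'I_n}) i j : C \in D -> i \in C ->
  j \in C -> i != j -> pair_prob P S i j = 0.
Proof.
move=> CD iC jC ij; apply: big1 => A /andP[iA jA].
apply: (group_law_eq0 C A CD).
have sub : [set i; j]%SET \subset A :&: C.
  by rewrite finset.subUset !finset.sub1set !inE iA jA iC jC.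
by have := subset_leq_card sub; rewrite cards2 ij.
Qed.

Lemma group_pair_prob_diff (C C' : {set 'I_n}) i j : C \in D -> C' \in D ->
  C != C' -> i \in C -> j \in C' ->
  pair_prob P S i j = inclusion_prob P S i * inclusion_prob P S j.
Proof.
have [_ _ _ _ indep] := group; move=> CD CD' CC iC jC.
pose B (X : {set 'I_n}) := if X == C then [set i]%SET else [set j]%SET.
have BC : B C = [set i]%SET by rewrite /B eqxx.
have BC' : B C' = [set j]%SET by rewrite /B eq_sym (negPf CC).
have sub : [set C; C']%SET \subset D.
  by rewrite finset.subUset !finset.sub1set CD CD'.
have := indep _ B sub.
rewrite big_setU1 ?inE //= big_set1 BC BC' !pr_group_setI1 // => <-.
rewrite (_ : [set w | _] =
    [set w | (S w :&: C == [set i]%SET) && (S w :&: C' == [set j]%SET)]); last first.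
  apply/seteqP; split => w /=.
    by move=> h; rewrite -BC -BC' !h ?eqxx // !inE eqxx ?orbT.
  by move=> /andP[/eqP h /eqP h'] X; rewrite !inE => /orP[]/eqP ->;
    rewrite ?BC ?BC'.
rewrite (pr_samplingE P S hS
  (fun A => (A :&: C == [set i]%SET) && (A :&: C' == [set j]%SET))).
rewrite /pair_prob big_mkcond [RHS]big_mkcond; apply: eq_bigr => A _.
have [->|lA] := eqVneq (law P S A) 0; first by rewrite !if_same.
by rewrite !group_setI1.
Qed.

(** The diagonal weight of the index [i]: [1 / p i - 1] if [i] is isolated, and
    [1 / p i] otherwise. *)
Definition group_weight (i : 'I_n) : R :=
  (inclusion_prob P S i)^-1 - (isolated_index D i)%:R.

(** Summed over [i], this gives the covariance form as
    [\sum_i |a i|^2 / p i] minus the sum of [|\sum_(i in C) a i|^2] over the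
    groups [C]. *)
Lemma group_cov_row (d : nat) (a : 'I_n -> 'cV[R]_d) (C : {set 'I_n}) i :
  C \in D -> i \in C ->
  \sum_j indicator_cov P S i j * dotp (a i) (a j)
  = (inclusion_prob P S i)^-1 * dotp (a i) (a i) - \sum_(j in C) dotp (a i) (a j).
Proof.
have [_ Dpart _ _ _] := group; move=> CD iC.
have p0 k : inclusion_prob P S k != 0 by rewrite gt_eqF.
rewrite (bigID (mem C)) /= [X in _ + X]big1 ?addr0 => [|j jC]; last first.
  have jcov : j \in finset.cover D by rewrite (cover_partition Dpart) inE.
  rewrite /indicator_cov.
  rewrite (group_pair_prob_diff C (finset.pblock D j)) ?pblock_mem //.
  - by rewrite divff ?mulf_neq0 // subrr mul0r.
  - by apply: contraNneq jC => ->; rewrite finset.mem_pblock.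
  - by rewrite finset.mem_pblock.
rewrite (bigD1 i) //= [in RHS](bigD1 i) //=.
have -> : indicator_cov P S i i = (inclusion_prob P S i)^-1 - 1.
  by rewrite /indicator_cov pair_probii // invfM mulrA mulfV // mul1r.
rewrite mulrBl mul1r opprD addrA; congr (_ + _).
rewrite -sumrN; apply: eq_bigr => j /andP[jC ji].
rewrite /indicator_cov (group_pair_prob_same C) // 1?eq_sym //.
by rewrite mul0r sub0r mulN1r.
Qed.

(** In each group [C], the subtracted term [|\sum_(i in C) a i|^2] is at least
    the sum of [|a i|^2] over the isolated [i] in [C]. *)
Lemma group_cov_form (d : nat) (a : 'I_n -> 'cV[R]_d) :
  \sum_i \sum_j indicator_cov P S i j * dotp (a i) (a j)
  <= \sum_i group_weight i * dotp (a i) (a i).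
Proof.
have [_ Dpart _ _ _] := group.
have split_groups (f : 'I_n -> R) : \sum_i f i = \sum_(C in D) \sum_(i in C) f i.
  rewrite -(finset.set_partition_big _ Dpart).
  by apply: eq_bigl => i; rewrite inE.
rewrite !split_groups; apply: ler_sum => C CD.
rewrite (eq_bigr _ (fun i iC => group_cov_row d a C i CD iC)) sumrB.
under [X in _ <= X]eq_bigr do rewrite /group_weight mulrBl.
rewrite sumrB lerD2l lerN2.
(* A group with two or more elements contains no isolated index. *)
have [/cards1P[k Ck]|C1] := boolP (#|C| == 1%N).
  by rewrite Ck !big_set1 ler_piMl ?dotp_ge0 // lern1 leq_b1.
rewrite big1 => [|i iC].
  under eq_bigr do rewrite -dotp_sumr.
  by rewrite -dotp_suml dotp_ge0.
suff /negPf -> : ~~ isolated_index D i by rewrite mul0r.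
apply: contra C1 => iD; apply/cards1P; exists i.
have tD := partition_trivIset Dpart.
rewrite -(finset.def_pblock tD CD iC).
by rewrite (finset.def_pblock tD iD (finset.set11 i)).
Qed.

End GroupSampling.

(** * Maxima over index sets *)

Section Maximum.
Context {R : realType} {n : nat}.

Lemma maximum_predT (b : 'I_n -> R) : (0 < n)%N ->
  exists2 i, maximum predT b = (b i)%:E & forall j, b j <= b i.
Proof.
move=> n0; have [//|j _|i _ E] :=
  @eq_bigmax _ _ _ (-oo%E : \bar R) (Ordinal n0) predT (fun i => (b i)%:E).
  by rewrite leNye.
exists i => // j; rewrite -lee_fin -E; exact: le_bigmax.
Qed.

Lemma maxe_maximum_if (Q : pred 'I_n) (a b : 'I_n -> R) :
  maxe (maximum Q a) (maximum (fun i => ~~ Q i) b)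
  = maximum predT (fun i => if Q i then a i else b i).
Proof.
rewrite [RHS]/maximum (bigID Q) /=; congr (maxe _ _).
  by apply: eq_bigr => i ->.
by apply: eq_bigr => i /negPf ->.
Qed.

End Maximum.

(** * The bounds on the expected smoothness constant *)

Theorem lemmaF3 (R : realType) (n d : nat) (hn : (0 < n)%N) (hd : (0 < d)%N)
    (dsp : measure_display) (Omega : measurableType dsp)
    (P : probability Omega R) (S : Omega -> {set 'I_n})
    (hS : sampling S) (hproper : proper_sampling P S)
    (F : 'I_n -> 'cV[R]_d -> R) (L : 'I_n -> R) (Lf : R)
    (hFsmooth : forall i, smooth (L i) (F i))
    (hFconvex : forall i, convex (F i))
    (hfsmooth : smooth Lf (average F))
    (hfconvex : convex (average F)) :
  let p := inclusion_prob P S in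
  let theta := fun (A : {set 'I_n}) (i : 'I_n) => 1 / p i in
  (forall tau : nat, (2 <= n)%N -> nice_sampling P S tau ->
     exists L2 : R, is_expected_smoothness_constant P S theta F L2 /\
       (L2%:E <= ((n%:R - tau%:R) / (tau%:R * (n%:R - 1)))%:E
                 * maximum predT L)%E)
  /\
  (forall (q : 'I_n -> R) (D : {set {set 'I_n}}), group_sampling P S q D ->
     exists L2 : R, is_expected_smoothness_constant P S theta F L2 /\
       (L2%:E <= (n%:R^-1)%:E
                 * maxe (maximum (fun i => isolated_index D i)
                                 (fun i => ((1 / p i - 1) * L i)%R))
                        (maximum (fun i => ~~ isolated_index D i)
                                 (fun i => (L i / p i)%R)))%E).
Proof.
move=> p theta.
have L0 i : 0 <= L i by exact: smooth_ge0 (hFsmooth i).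
have nR : 0 < n%:R :> R by rewrite ltr0n.
have [df _] := hfsmooth.
split=> [tau n2 nice|q D group].
- have [/andP[tau1 taun] _] := nice.
  have [i0 -> Lmax] := maximum_predT L hn.
  set k := _ / _.
  have k0 : 0 <= k.
    by rewrite divr_ge0 ?mulr_ge0 ?subr_ge0 ?ler_nat ?ler1n.
  have [c cP cM] : exists2 c, is_expected_smoothness_constant P S theta F c
      & c <= k * L i0.
    apply: expected_smoothness_constant_exists => //.
    apply: (expected_smoothness_of_diagonal P S hS hproper F L
      (fun=> k * n%:R)) => //.
    + by move=> i; rewrite mulr_ge0 // ltW.
    + by rewrite mulr_ge0.
    + by move=> i; rewrite mulrAC mulrC ler_wpM2l ?ler_wpM2l // ltW.
    + by move=> a; exact: nice_cov_form.
  by exists c; split => //; rewrite -EFinM lee_fin.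
- rewrite maxe_maximum_if.
  set b := (X in maximum predT X); have [i0 -> bmax] := maximum_predT b hn.
  have w0 i : 0 <= group_weight P S D i.
    rewrite subr_ge0 (@le_trans _ _ 1) ?lern1 ?leq_b1 //.
    by rewrite invf_ge1 ?inclusion_prob_le1.
  have bE i : b i = group_weight P S D i * L i.
    rewrite /b /group_weight -/p; case: ifP => _; last by rewrite subr0 mulrC.
    by rewrite div1r.
  have [c cP cM] : exists2 c, is_expected_smoothness_constant P S theta F c
      & c <= n%:R^-1 * b i0.
    apply: expected_smoothness_constant_exists => //.
    apply: (expected_smoothness_of_diagonal P S hS hproper F L
      (group_weight P S D)) => //.
    + by rewrite bE !mulr_ge0 // invr_ge0 ltW.
    + by move=> i; rewrite mulVKf ?gt_eqF // -bE.
    + by move=> a; apply: group_cov_form; eassumption.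
  by exists c; split => //; rewrite -EFinM lee_fin.
Qed.
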